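(* Let $G$ be a subgroup of $PL_o(I)$, the group of orientation preserving piecewise linear homeomorphisms of $I=[0,1]$. If $G$ satisfies a law, then $G$ is solvable.
   Context: $PL_o(I)$ is the group, under composition, of orientation preserving piecewise linear homeomorphisms of $I=[0,1]$ (each element having only finitely many points of non-differentiability). A group $G$ satisfies a law if there are an integer $k\ge 1$ and a non-trivial reduced word $w(x_1,\dots,x_k)$ in the free group on $x_1,\dots,x_k$ such that $w(g_1,\dots,g_k)=1$ for all $g_1,\dots,g_k\in G$. *)

(* Defs.v *)
From HB Require Import structures.
From mathcomp Require Import all_boot all_order all_algebra.
From mathcomp Require Import all_classical all_reals all_analysis.

Set Implicit Arguments.
Unset Strict Implicit.
Unset Printing Implicit Defensive.

Import Order.TTheory GRing.Theory Num.Theory.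
Import numFieldNormedType.Exports.

Local Open Scope classical_set_scope.
Local Open Scope ring_scope.

Section GroupNotions.
Local Open Scope group_scope.
Variable gT : groupType.
Implicit Types G H : set gT.

Definition is_subgroup H : Prop := group_closed [in H].

Definition commutator_subgroup H : set gT :=
  smallest is_subgroup [set [~ x, y] | x in H & y in H].

Definition derived_series (n : nat) G : set gT := iter n commutator_subgroup G.

Definition solvable_group G : Prop :=
  exists n : nat, derived_series n G = [set 1].

(* The letter (i, false) stands for x_i and (i, true) for its inverse. *)
Definition reduced_word k (w : seq ('I_k * bool)) : bool :=
  sorted (fun a b => b != (a.1, ~~ a.2)) w.

Definition eval_word k (g : 'I_k -> gT) (w : seq ('I_k * bool)) : gT :=
  \prod_(a <- w) (if a.2 then (g a.1)^-1 else g a.1).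

Definition satisfies_law G : Prop :=
  exists k : nat, (0 < k)%N /\
  exists w : seq ('I_k * bool), [/\ w != [::], reduced_word w &
    forall g : 'I_k -> gT, (forall i, G (g i)) -> eval_word g w = 1].

End GroupNotions.

Section PLHomeomorphisms.
Variable R : realType.

(* [0, 1] as a topological space of its own: the type of its points, with the
   topology induced from R. *)
Definition unit_itv : Type := set_type (`[0, 1] : set R).
HB.instance Definition _ := Topological.on unit_itv.
Implicit Types f g : unit_itv -> unit_itv.

Definition homeomorphism f : Prop :=
  continuous f /\
  exists g, [/\ cancel f g, cancel g f & continuous g].

Definition orientation_preserving f : Prop :=
  forall x y : unit_itv, \val x < \val y -> \val (f x) < \val (f y).

Definition affine_between f (x y : unit_itv) : Prop :=
  exists a b : R, forall z : unit_itv,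
    \val x <= \val z <= \val y -> \val (f z) = a * \val z + b.

(* The finite set B contains the breakpoints of f: f is affine on every closed
   subinterval of [0, 1] whose interior misses B. *)
Definition piecewise_linear f : Prop :=
  exists2 B : set unit_itv, finite_set B &
    forall x y : unit_itv,
      (forall z : unit_itv, \val x < \val z < \val y -> ~ B z) ->
      affine_between f x y.

Definition PL_homeo f : Prop :=
  [/\ homeomorphism f, orientation_preserving f & piecewise_linear f].

Definition PLo : Type := set_type [set f | PL_homeo f].
HB.instance Definition _ := Choice.on PLo.

Lemma PLoP (f : PLo) : PL_homeo (\val f).
Proof. by have := valP f; rewrite inE. Qed.

Definition mkPLo f (fP : PL_homeo f) : PLo := SigSub (mem_set fP).

Lemma le_orientation f (x y : unit_itv) :
  orientation_preserving f -> \val x <= \val y -> \val (f x) <= \val (f y).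
Proof.
move=> fO; rewrite le_eqVlt => /orP[/eqP/val_inj -> //|/fO]; exact: ltW.
Qed.

Lemma orientation_preservingV f g :
  cancel g f -> orientation_preserving f -> orientation_preserving g.
Proof.
move=> gK fO x y xy; rewrite ltNge; apply/negP => /(le_orientation fO).
by rewrite !gK leNgt xy.
Qed.

Lemma PL_homeo_id : PL_homeo id.
Proof.
split=> //.
- split; first by move=> x; exact: cvg_id.
  by exists id; split=> // x; exact: cvg_id.
- exists set0; first exact: finite_set0.
  by move=> x y _; exists 1, 0 => z _; rewrite mul1r addr0.
Qed.

Lemma PL_homeo_comp f g : PL_homeo f -> PL_homeo g -> PL_homeo (f \o g).
Proof.
case=> -[fc [f' [fK f'K f'c]]] fO [B finB fB].
case=> -[gc [g' [gK g'K g'c]]] gO [C finC gC].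
have g'O := orientation_preservingV g'K gO.
split.
- split; first by move=> x; apply: continuous_comp; [exact: gc|exact: fc].
  exists (g' \o f'); split; first exact: can_comp.
    exact: can_comp.
  by move=> x; apply: continuous_comp; [exact: f'c|exact: g'c].
- by move=> x y /gO/fO.
- exists (C `|` g' @` B); first by rewrite finite_setU; split=> //; exact: finite_image.
  move=> x y xyCB.
  have [z /xyCB nz|a [b gE]] := gC x y; first by apply: contra_not nz; left.
  have [z /andP[xz zy] Bz|c [d fE]] := fB (g x) (g y).
    apply: (xyCB (g' z)); last by right; exists z.
    by have := g'O _ _ xz; have := g'O _ _ zy; rewrite !gK => -> ->.
  exists (c * a), (c * b + d) => z /[dup] xzy /andP[xz zy].
  rewrite /= fE; last by rewrite !le_orientation.
  by rewrite gE // mulrDr mulrA addrA.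
Qed.

Lemma PL_homeo_inv f g :
  PL_homeo f -> cancel f g -> cancel g f -> PL_homeo g.
Proof.
case=> -[fc [f' [fK f'K f'c]]] fO [B finB fB] fgK gK.
have gO := orientation_preservingV gK fO.
have -> : g = f' by apply/funext => x; rewrite -{1}(f'K x) fgK.
have f'O := orientation_preservingV f'K fO.
split=> //; first by split=> //; exists f.
exists (f @` B); first exact: finite_image.
move=> x y xyB.
have [xy|yx|/val_inj <-] := ltgtP (\val x) (\val y); first last.
- exists 0, (\val (f' x)) => z /le_anti /val_inj <-.
  by rewrite mul0r add0r.
- exists 0, 0 => z /andP[xz zy].
  by have := le_lt_trans (le_trans xz zy) yx; rewrite ltxx.
have [z /andP[xz zy] Bz|a [b fE]] := fB (f' x) (f' y).
  apply: (xyB (f z)); last by exists z.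
  by have := fO _ _ xz; have := fO _ _ zy; rewrite !f'K => -> ->.
have f'xy := f'O _ _ xy.
have xE : \val x = a * \val (f' x) + b.
  by rewrite -fE ?f'K // lexx ltW.
have yE : \val y = a * \val (f' y) + b.
  by rewrite -fE ?f'K // lexx ltW.
have a0 : a != 0.
  by apply/eqP => a0; move: xy; rewrite xE yE a0 !mul0r ltxx.
exists a^-1, (- (a^-1 * b)) => z /andP[xz zy].
rewrite -{2}(f'K z) fE; last by rewrite !le_orientation.
by rewrite mulrDr mulKf // addrK.
Qed.

Definition PLo_one : PLo := mkPLo PL_homeo_id.

Definition PLo_mul (f g : PLo) : PLo :=
  mkPLo (PL_homeo_comp (PLoP f) (PLoP g)).

Lemma PLo_inv_subproof (f : PLo) :
  exists g : PLo, cancel (\val f) (\val g) /\ cancel (\val g) (\val f).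
Proof.
have [[_ [g [fK gK _]]] _ _] := PLoP f.
by exists (mkPLo (PL_homeo_inv (PLoP f) fK gK)).
Qed.

Definition PLo_inv (f : PLo) : PLo := projT1 (cid (PLo_inv_subproof f)).

Lemma PLo_mulA : associative PLo_mul.
Proof. by move=> f g h; exact/val_inj. Qed.

Lemma PLo_mul1 : left_id PLo_one PLo_mul.
Proof. by move=> f; exact/val_inj. Qed.

Lemma PLo_1mul : right_id PLo_one PLo_mul.
Proof. by move=> f; exact/val_inj. Qed.

Lemma PLo_mulV : left_inverse PLo_one PLo_inv PLo_mul.
Proof.
move=> f; apply/val_inj/funext => x /=.
by rewrite /PLo_inv; case: cid => g [fK gK] /=; rewrite fK.
Qed.

Lemma PLo_mulVr : right_inverse PLo_one PLo_inv PLo_mul.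
Proof.
move=> f; apply/val_inj/funext => x /=.
by rewrite /PLo_inv; case: cid => g [fK gK] /=; rewrite gK.
Qed.

HB.instance Definition _ :=
  isGroup.Build PLo PLo_mulA PLo_mul1 PLo_1mul PLo_mulV PLo_mulVr.

End PLHomeomorphisms.

(* Main.v *)
Require Import Defs.
From mathcomp Require Import all_boot all_order all_algebra.
From mathcomp Require Import all_classical all_reals all_analysis.
From mathcomp Require Import zify ring lra.

(* Let H be a subgroup and x a point moved by H^(2n). We build inside H an
   iterated wreath product of height n around x, and this violates every word of
   length at most n. If H' has no fixed point in the orbital (a, b) of H around
   x, then, as germs at a and b have slope 1 in H', each element of H' has
   compact support in (a, b), and any compact subinterval is displaced by an
   element of H'. Otherwise some g in H moves a fixed point of H' across x, the
   endpoints of the orbital of g are fixed by H', and each element of H'' has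
   compact support in that orbital, so a power of g displaces this support;
   then one recurses in H''.
   For the word: substituting a displacing element t for the first letter x_1
   and products of t-conjugates for the other letters turns w into x_1^e w',
   where w' is reduced, shorter, and evaluated at arbitrary elements. *)

Set Implicit Arguments.
Unset Strict Implicit.
Unset Printing Implicit Defensive.

Import Order.TTheory GRing.Theory Num.Theory.
Import numFieldNormedType.Exports.

Local Open Scope classical_set_scope.
Local Open Scope ring_scope.

(** * Integer powers and subgroups of an abstract group *)

Definition zpow (gT : groupType) (t : gT) (e : int) : gT :=
  (match e with Posz n => t ^+ n | Negz n => t ^- n.+1 end)%g.

Lemma zpow1D (gT : groupType) (t : gT) e : zpow t (e + 1) = (t * zpow t e)%g.
Proof.
case: e => [n|[|n]].
- by rewrite -PoszD addn1 /= expgS.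
- by rewrite /= mulgV.
- have -> : Negz n.+1 + 1 = Negz n by lia.
  by rewrite /= (expgSr t n.+1) invgM mulVKg.
Qed.

Lemma zpowB1 (gT : groupType) (t : gT) e : zpow t (e - 1) = (t^-1 * zpow t e)%g.
Proof. by rewrite -[in RHS](subrK 1 e) zpow1D mulKg. Qed.

Lemma zpowD (gT : groupType) (t : gT) d e :
  zpow t (d + e) = (zpow t d * zpow t e)%g.
Proof.
elim/int_ind: d => [|n IHn|n IHn]; first by rewrite add0r mul1g.
- by rewrite -addn1 PoszD addrAC !zpow1D IHn mulgA.
- by rewrite -addn1 PoszD opprD addrAC !zpowB1 IHn mulgA.
Qed.

Lemma zpowN (gT : groupType) (t : gT) e : zpow t (- e) = ((zpow t e)^-1)%g.
Proof. by apply/esym/mulg1_eq; rewrite -zpowD addrN. Qed.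

Lemma subgroup1 (gT : groupType) (S : set gT) : is_subgroup S -> S 1%g.
Proof. by case; rewrite inE. Qed.

Lemma subgroupV (gT : groupType) (S : set gT) (g : gT) :
  is_subgroup S -> S g -> S (g^-1)%g.
Proof. by move=> /group_closedV SV Sg; have := SV g; rewrite !inE; apply. Qed.

Lemma subgroupM (gT : groupType) (S : set gT) (g h : gT) :
  is_subgroup S -> S g -> S h -> S (g * h)%g.
Proof.
by move=> /group_closedM SM Sg Sh; have := SM g h; rewrite !inE; apply.
Qed.

Lemma subgroupP (gT : groupType) (S : set gT) : S 1%g ->
  (forall g h, S g -> S h -> S (g * h)%g) -> (forall g, S g -> S (g^-1)%g) ->
  is_subgroup S.
Proof.
move=> S1 SM SV; split; first by rewrite inE.
by move=> g h; rewrite !inE => Sg Sh; apply/SM/SV.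
Qed.

Lemma subgroup_zpow (gT : groupType) (S : set gT) (t : gT) e :
  is_subgroup S -> S t -> S (zpow t e).
Proof.
move=> SG St; elim/int_ind: e => [|n IHn|n IHn]; first exact: subgroup1.
- by rewrite -addn1 PoszD zpow1D; exact: (subgroupM SG).
- by rewrite -addn1 PoszD opprD zpowB1; apply: (subgroupM SG) => //; exact: subgroupV.
Qed.

(** * Reduced words and their normal form relative to one letter *)

Definition reduced (T : eqType) (w : seq (T * bool)) : bool :=
  sorted (fun a b => b != (a.1, ~~ a.2)) w.

(** As for [reduced], the alphabet is arbitrary: the induction on words passes from [T] to
    [T * int]. *)
Definition word_val (gT : groupType) (T : Type) (h : T -> gT)
    (w : seq (T * bool)) : gT :=
  (\prod_(a <- w) (if a.2 then (h a.1)^-1 else h a.1))%g.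

(* [rewrite_word i0 w = (e, w')] is the normal form w = x_i0^e w', where the
   letter (i, j) of w' stands for the conjugate x_i0^-j x_i x_i0^j. *)
Fixpoint rewrite_word (T : eqType) (i0 : T) (w : seq (T * bool)) :
    int * seq ((T * int) * bool) :=
  if w is a :: w1 then
    let: (e, w') := rewrite_word i0 w1 in
    if a.1 == i0 then (if a.2 then e - 1 else e + 1, w')
    else (e, ((a.1, e), a.2) :: w')
  else (0, [::]).

Lemma size_rewrite_word (T : eqType) (i0 : T) w :
  (size (rewrite_word i0 w).2 <= size w)%N.
Proof.
elim: w => //= a w; case: rewrite_word => e w' /= IHw.
by case: ifP => //= _; exact: leqW.
Qed.

(* Between two letters of w' with the same exponent j the exponent of x_i0 in w
   returns to j, so if w is reduced then no power of x_i0 separates them. *)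
Lemma rewrite_word_reduced (T : eqType) (i0 : T) w : reduced w ->
  let: (e, w') := rewrite_word i0 w in
  let e0 := if w' is b :: _ then b.1.2 else 0 in
  reduced w' /\
  if w is a :: _ then
    if a.1 == i0 then is_true (if a.2 then e < e0 else e0 < e)
    else exists w2, w' = ((a.1, e), a.2) :: w2
  else w' = [::] /\ e = 0.
Proof.
elim: w => [|a w IHw] // aw.
have /IHw : reduced w by move: aw; rewrite /reduced; case: w {IHw} => //= b w /andP[].
rewrite [rewrite_word _ (a :: _)]/=.
case: rewrite_word => e w'; case: w aw {IHw} => [|b w] /=.
  move=> _ [_ [-> ->]]; case: ifP => _ /=; first by split => //; case: a.2; lia.
  by split => //; exists [::].
case/andP=> ba _ [w'r]; case: (eqVneq b.1 i0) => [bi|bi] be.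
  case: (eqVneq a.1 i0) => [ai|ai]; split=> //.
  (* Being adjacent in a reduced word, the two letters have the same sign, so the exponent keeps
     moving away from [e0]. *)
  - have -> : a.2 = b.2.
      move: ba; rewrite -pair_eqE /= bi ai eqxx /=; by case: a.2; case: b.2.
    by case: b.2 be; lia.
  (* The exponent has moved away from that of the head of [w'], so the new letter cannot cancel this
     head. *)
  - case: w' w'r be => //= c w' -> be; rewrite andbT.
    apply/eqP => cE; move: be; rewrite cE /= ltxx; by case: b.2.
  - by exists w'.
case: be w'r => w2 -> w'r; case: (eqVneq a.1 i0) => [ai|ai]; split=> //.
- by rewrite /=; case: a.2; lia.
(* Both letters carry the exponent [e], so a cancellation in [w'] would already be one in [w]. *)
- move: w'r; rewrite /reduced /= => ->; rewrite andbT.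
  apply: contra_neq ba; by case: b {bi} => b1 b2 /= [-> ->].
- by eexists.
Qed.

(** The leading letter goes into the exponent, so [w'] is strictly shorter than the whole word. If
    [w'] is empty, the word is a power of [x_i0] without cancellation, whence [e != 0]. *)
Lemma rewrite_word_head (T : eqType) (i0 : T) b w : reduced ((i0, b) :: w) ->
  let: (e, w') := rewrite_word i0 ((i0, b) :: w) in
  [/\ reduced w', (size w' <= size w)%N & w' = [::] -> e != 0].
Proof.
move=> wr; have := rewrite_word_reduced i0 wr.
have : (size (rewrite_word i0 ((i0, b) :: w)).2 <= size w)%N.
  by have := size_rewrite_word i0 w; rewrite /= eqxx; case: rewrite_word.
case: rewrite_word => e w' sw [w'r] /=; rewrite eqxx => be.
by split=> // w'0; move: be; rewrite w'0; case: b {wr}; lia.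
Qed.

(** * Wreath towers and the failure of laws *)

(* On the translate t^j E the elements of l act trivially unless j = 0, so that
   l and t generate on the union of these translates an analogue of a wreath
   product with Z. *)
Definition wreath_pair (gT : groupType) (X : Type) (act : gT -> X -> X) (t : gT)
    (E : set X) (l : seq gT) : Prop :=
  (forall (j : int) z, j != 0 -> E z -> ~ E (act (zpow t j) z)) /\
  forall f, f \in l ->
    (forall z, E z -> E (act f z) /\ E (act (f^-1)%g z)) /\
    (forall (j : int) z, j != 0 -> E z -> act f (act (zpow t j) z) = act (zpow t j) z).

(** The point [x] lies in every displaced set. A word has finitely many letters, so [t] and [E] may
    depend on a finite list [l]. *)
Fixpoint wreath_tower (gT : groupType) (X : Type) (act : gT -> X -> X) (x : X)
    (n : nat) (S : set gT) : Prop :=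
  if n is m.+1 then
    exists S' : set gT, [/\ is_subgroup S', S' `<=` S, wreath_tower act x m S' &
      forall l : seq gT, (forall f, f \in l -> S' f) ->
      exists t E, [/\ S t, E x & wreath_pair act t E l]]
  else True.

Lemma wreath_tower_sub (gT : groupType) (X : Type) (act : gT -> X -> X) x n
  (S1 S2 : set gT) :
  S1 `<=` S2 -> wreath_tower act x n S1 -> wreath_tower act x n S2.
Proof.
case: n => // n S12 [S' [S'G S'S S't S'w]]; exists S'; split=> //.
  exact: subset_trans S12.
by move=> l /S'w [t [E [/S12 St Ex tE]]]; exists t, E.
Qed.

(** The factor of index [(i, j)] acts inside [t^j E] and trivially on the other translates, so on
    [t^e E] only the one with [j = e] counts; [uniq s] makes it occur at most once. *)
Lemma act_conj_prod (gT : groupType) (X : Type) (act : gT -> X -> X)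
  (act1 : forall x, act 1%g x = x)
  (actM : forall g h x, act (g * h)%g x = act g (act h x))
  (T : eqType) (t : gT) (E : set X) (f : T * int -> gT) (s : seq (T * int)) i e z :
  wreath_pair act t E (map f s) -> uniq s -> E z ->
  act (\prod_(p <- s | p.1 == i) (zpow t p.2 * f p * zpow t (- p.2)))%g
    (act (zpow t e) z) =
  act (zpow t e) (if (i, e) \in s then act (f (i, e)) z else z).
Proof.
move=> [tE fE]; elim: s fE => [|p s IHs] fE; first by rewrite big_nil act1.
move=> /= /andP[ps us] Ez; rewrite big_cons in_cons.
have sE g : g \in map f s -> g \in map f (p :: s).
  by rewrite /= in_cons orbC => ->.
have {}IHs := IHs (fun g gs => fE g (sE g gs)) us Ez.
have [fE0 fEj] := fE (f p) (mem_head _ _).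
case: (eqVneq p.1 i) => [pi|pi]; last first.
  by rewrite IHs -pair_eqE /= eq_sym (negbTE pi).
rewrite actM IHs; case: (eqVneq (i, e) p) => [pE|pE] /=.
  rewrite -pE in ps *; rewrite (negbTE ps) /=.
  by rewrite !actM -(actM (zpow t (- e))) -zpowD addNr act1.
have e0 : - p.2 + e != 0.
  by apply: contra_neq pE => ?; rewrite [p]surjective_pairing pi; congr pair; lia.
set y := if _ then _ else _.
have Ey : E y.
  rewrite /y; case: ifP => // pis.
  by case: (fE (f (i, e))) => [|+ _]; [rewrite in_cons map_f ?orbT|move=> /(_ z Ez)[]].
rewrite !actM -(actM (zpow t (- p.2))) -zpowD fEj //.
by rewrite -actM -zpowD addrA subrr add0r.
Qed.

(** Letters act from the right. When the exponent of [x_i0] read so far is [e], the point is in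
    [t^e E], where [h i] acts as the conjugate of [f (i, e)] by [t^e]. *)
Lemma wreath_rewrite (gT : groupType) (X : Type) (act : gT -> X -> X)
  (act1 : forall x, act 1%g x = x)
  (actM : forall g h x, act (g * h)%g x = act g (act h x))
  (T : eqType) (i0 : T) (t : gT) (E : set X) (f : T * int -> gT) w
  (s := undup (map fst (rewrite_word i0 w).2))
  (h := fun i => if i == i0 then t else
     (\prod_(p <- s | p.1 == i) (zpow t p.2 * f p * zpow t (- p.2)))%g) z :
  wreath_pair act t E (map f s) -> E z ->
  let: (e, w') := rewrite_word i0 w in
  act (word_val h w) z = act (zpow t e) (act (word_val f w') z) /\
  E (act (word_val f w') z).
Proof.
move=> tE Ez.
(* [s] comes from the whole word, so the induction runs over words [v] whose rewritten letters lie
   in [s]. *)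
suff: forall v, {subset map fst (rewrite_word i0 v).2 <= s} ->
  let: (e, w') := rewrite_word i0 v in
  act (word_val h v) z = act (zpow t e) (act (word_val f w') z) /\
  E (act (word_val f w') z).
  by apply=> p; rewrite mem_undup.
elim=> [|a v IHv] vs; first by rewrite /= /word_val !big_nil (act1 (act _ z)) act1.
rewrite /=; move: IHv vs; rewrite /=; case: rewrite_word => e w' IHv.
case: (eqVneq a.1 i0) => [ai|ai] vs.
  have [IH1 Ew'] := IHv vs.
  rewrite [word_val h _]big_cons actM -/(word_val h v) IH1 /h ai eqxx.
  by split=> //; case: a.2; rewrite -actM ?zpowB1 ?zpow1D.
have [|IH1 Ew'] := IHv; first by move=> p pw'; rewrite vs //= in_cons pw' orbT.
have as_ : (a.1, e) \in s by apply: vs; rewrite mem_head.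
have [fE _] := (proj2 tE) (f (a.1, e)) (map_f f as_).
rewrite /word_val !big_cons !actM -/(word_val h v) -/(word_val f w') IH1 /=.
have hE y : E y -> act (h a.1) (act (zpow t e) y) = act (zpow t e) (act (f (a.1, e)) y).
  by move=> Ey; rewrite /h (negbTE ai) (act_conj_prod act1 actM _ _ tE) ?undup_uniq ?as_.
have [E1 E2] := fE _ Ew'; case: a.2; split=> //; last exact: hE.
rewrite -{1}[act (word_val f w') z](act1) -(mulgV (f (a.1, e))) actM -hE //.
by rewrite -actM mulVg act1.
Qed.

Theorem wreath_tower_no_law (gT : groupType) (X : Type) (act : gT -> X -> X)
  (act1 : forall x, act 1%g x = x)
  (actM : forall g h x, act (g * h)%g x = act g (act h x))
  (x : X) n (T : eqType) (S : set gT) (w : seq (T * bool)) :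
  is_subgroup S -> wreath_tower act x n S ->
  w != [::] -> reduced w -> (size w <= n)%N ->
  exists h : T -> gT, (forall i, S (h i)) /\ act (word_val h w) x <> x.
Proof.
elim: n T S w => [|n IHn] T S w SG; first by case: w.
move=> [S' [S'G S'S S't S'w]]; case: w => // -[i0 b] w _ wr sw.
have := rewrite_word_head wr; set w0 := (i0, b) :: w in wr *.
case wE: (rewrite_word i0 w0) => [e w'] [w'r sw' we].
(* An empty [w'] leaves only a power of [t], and any [f] will do. *)
have [f [Sf fx]] : exists f : T * int -> gT, (forall p, S' (f p)) /\
    (w' != [::] -> act (word_val f w') x <> x).
  case: (eqVneq w' [::]) => [_|w'0]; last first.
    by have [|f [Sf fx]] := IHn _ _ w' S'G S't w'0 w'r; [exact: (leq_trans sw')|exists f].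
  by exists (fun=> 1%g); split=> // _; exact: subgroup1.
pose s := undup (map fst w').
have [_ /mapP[p _ ->]//|t [E [St Ex tE]]] := S'w (map f s).
pose h i := if i == i0 then t else
     (\prod_(p <- s | p.1 == i) (zpow t p.2 * f p * zpow t (- p.2)))%g.
exists h; split=> [i|].
  rewrite /h; case: ifP => // _; elim/big_ind: _ => [||p _].
  - exact: subgroup1.
  - by move=> ? ?; exact: subgroupM.
  - apply: (subgroupM SG); last exact: subgroup_zpow.
    by apply: (subgroupM SG); [exact: subgroup_zpow|exact/S'S].
have := @wreath_rewrite _ _ act act1 actM T i0 t E f w0 x.
rewrite wE /= => /(_ tE Ex)[-> Ew'].
(* For [e != 0], [t^e] takes a point of [E] out of [E], which contains [x]; for [e = 0], [w'] is
   nonempty and moves [x]. *)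
case: (eqVneq e 0) => [e0|e0 te]; last by case: tE => /(_ _ _ e0 Ew') + _; rewrite te.
rewrite e0 act1; apply: fx; apply/eqP => /we; by rewrite e0 eqxx.
Qed.

(** * Commutator subgroups *)

Lemma commutator_subgroup_closed (gT : groupType) (H : set gT) :
  is_subgroup (commutator_subgroup H).
Proof.
apply: subgroupP => [A [AG _]|f g Hf Hg A HA|f Hf A HA].
- exact: subgroup1.
- by apply: subgroupM; [case: HA|exact: Hf|exact: Hg].
- by apply: subgroupV; [case: HA|exact: Hf].
Qed.

Lemma commutator_subgroup_min (gT : groupType) (H K : set gT) : is_subgroup K ->
  (forall u v, H u -> H v -> K [~ u, v]%g) -> commutator_subgroup H `<=` K.
Proof. by move=> KG HK; apply: smallest_sub => // _ [u Hu [v Hv <-]]; exact: HK. Qed.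

Lemma mem_commutator_subgroup (gT : groupType) (H : set gT) u v :
  H u -> H v -> commutator_subgroup H [~ u, v]%g.
Proof. by move=> Hu Hv A [_]; apply; exists u => //; exists v. Qed.

Lemma commutator_subgroup_sub (gT : groupType) (H : set gT) :
  is_subgroup H -> commutator_subgroup H `<=` H.
Proof.
move=> HG; apply: commutator_subgroup_min => // u v Hu Hv.
rewrite commgEl conjgE; do !apply: (subgroupM HG) => //; exact: subgroupV.
Qed.

(** Normality, from [f ^ g = f * [~ f, g]]. *)
Lemma commutator_subgroup_conj (gT : groupType) (H : set gT) f g :
  is_subgroup H -> commutator_subgroup H f -> H g ->
  commutator_subgroup H (f ^ g)%g.
Proof.
move=> HG Hf Hg; rewrite -(mulVKg f (f ^ g)%g) -commgEl.
apply: (subgroupM (@commutator_subgroup_closed _ H)) => //.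
by apply: mem_commutator_subgroup => //; exact: commutator_subgroup_sub.
Qed.

(** * The action on the interval and the ends of orbits *)

Definition pos (R : realType) (x : unit_itv R) : R := \val x.

Lemma pos_inj (R : realType) : injective (@pos R).
Proof. exact: val_inj. Qed.

Definition PLact (R : realType) (f : PLo R) : unit_itv R -> unit_itv R := \val f.

Definition fixed (R : realType) (H : set (PLo R)) (p : unit_itv R) : Prop :=
  forall f, H f -> PLact f p = p.

Lemma PLact1 (R : realType) (x : unit_itv R) : PLact 1%g x = x.
Proof. by []. Qed.

Lemma PLactM (R : realType) (f g : PLo R) x :
  PLact (f * g)%g x = PLact f (PLact g x).
Proof. by []. Qed.

Lemma PLactK (R : realType) (f : PLo R) : cancel (PLact f) (PLact (f^-1)%g).
Proof. by move=> x; rewrite -PLactM mulVg. Qed.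

Lemma PLactKV (R : realType) (f : PLo R) : cancel (PLact (f^-1)%g) (PLact f).
Proof. by move=> x; rewrite -PLactM mulgV. Qed.

Lemma PLact_le (R : realType) (f : PLo R) x y :
  (pos (PLact f x) <= pos (PLact f y)) = (pos x <= pos y).
Proof.
have [_ fO _] := PLoP f; apply/idP/idP; last exact: le_orientation.
by rewrite !leNgt; apply: contra => /fO.
Qed.

Lemma PLact_lt (R : realType) (f : PLo R) x y :
  (pos (PLact f x) < pos (PLact f y)) = (pos x < pos y).
Proof. by rewrite !ltNge PLact_le. Qed.

Lemma unit_itvP (R : realType) (x : unit_itv R) : 0 <= pos x <= 1.
Proof. by have := valP x; rewrite inE /= in_itv. Qed.

Lemma unit_itv_mk (R : realType) (r : R) : 0 <= r <= 1 ->
  exists x : unit_itv R, pos x = r.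
Proof.
move=> r01; have r_in : r \in (`[0, 1]%classic : set R) by rewrite inE /= in_itv.
by exists (SigSub r_in).
Qed.

(** Both [h] and its inverse move [s] weakly down, so neither moves it. *)
Lemma fixed_mono (R : realType) (H : set (PLo R)) (s : unit_itv R) :
  is_subgroup H -> (forall h, H h -> pos (PLact h s) <= pos s) -> fixed H s.
Proof.
move=> HG Hs h Hh; apply/pos_inj/le_anti; rewrite Hs //=.
by rewrite -(PLact_le (h^-1)%g) PLactK Hs //; exact: subgroupV.
Qed.

(** If some [h] raised the supremum of the orbit, it would carry nearby orbit points above this
    supremum. *)
Lemma orbit_sup (R : realType) (H : set (PLo R)) (x : unit_itv R) :
  is_subgroup H -> exists s, [/\ fixed H s, pos x <= pos s &
    forall r, r < pos s -> exists2 g, H g & r < pos (PLact g x)].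
Proof.
move=> HG; pose A : set R := [set pos (PLact g x) | g in H].
have A0 : A (pos x) by exists 1%g => //; exact: subgroup1.
have A1 : ubound A 1 by move=> _ [g _ <-]; case/andP: (unit_itvP (PLact g x)).
have supA : has_sup A by split; [exists (pos x)|exists 1].
have ub g : H g -> pos (PLact g x) <= sup A.
  by move=> Hg; apply: sup_upper_bound => //; exists g.
have [|s sE] := @unit_itv_mk R (sup A).
  rewrite ge_sup // ?andbT; last by exists (pos x).
  by rewrite (le_trans _ (ub _ (subgroup1 HG))) //; case/andP: (unit_itvP (PLact 1%g x)).
have near r : r < pos s -> exists2 g, H g & r < pos (PLact g x).
  rewrite sE => rs; have [|_ [g Hg <-] rg] := @sup_adherent _ A (sup A - r) _ supA.
    by rewrite subr_gt0.
  by exists g => //; move: rg; rewrite subKr.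
exists s; split=> //; last by rewrite sE; exact: (ub _ (subgroup1 HG)).
apply: fixed_mono => // h Hh; rewrite leNgt; apply/negP => hs.
have [|g Hg] := near (pos (PLact (h^-1)%g s)).
  by rewrite -(PLact_lt h) PLactKV.
rewrite -(PLact_lt h) PLactKV -PLactM ltNge sE ub //; exact: (subgroupM HG Hh Hg).
Qed.

Lemma orbit_inf (R : realType) (H : set (PLo R)) (x : unit_itv R) :
  is_subgroup H -> exists s, [/\ fixed H s, pos s <= pos x &
    forall r, pos s < r -> exists2 g, H g & pos (PLact g x) < r].
Proof.
move=> HG; pose A : set R := [set pos (PLact g x) | g in H].
have A0 : A (pos x) by exists 1%g => //; exact: subgroup1.
have A1 : lbound A 0 by move=> _ [g _ <-]; case/andP: (unit_itvP (PLact g x)).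
have infA : has_inf A by split; [exists (pos x)|exists 0].
have lb g : H g -> inf A <= pos (PLact g x).
  by move=> Hg; apply: ge_inf; [case: infA|exists g].
have [|s sE] := @unit_itv_mk R (inf A).
  rewrite lb_le_inf //=; last by exists (pos x).
  by rewrite (le_trans (lb _ (subgroup1 HG))) //; case/andP: (unit_itvP (PLact 1%g x)).
have near r : pos s < r -> exists2 g, H g & pos (PLact g x) < r.
  rewrite sE => rs; have [|_ [g Hg <-] rg] := @inf_adherent _ A (r - inf A) _ infA.
    by rewrite subr_gt0.
  by exists g => //; move: rg; rewrite addrC subrK.
exists s; split=> //; last by rewrite sE; exact: (lb _ (subgroup1 HG)).
have down h : H h -> pos s <= pos (PLact h s).
  move=> Hh; rewrite leNgt; apply/negP => hs.
  have [|g Hg] := near (pos (PLact (h^-1)%g s)).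
    by rewrite -(PLact_lt h) PLactKV.
  rewrite -(PLact_lt h) PLactKV -PLactM ltNge sE lb //; exact: (subgroupM HG Hh Hg).
apply: fixed_mono => // h Hh.
by rewrite -(PLact_le (h^-1)%g) PLactK; apply: down; exact: (subgroupV HG).
Qed.

(** * Germs at a fixed point *)

Lemma germ_affine (R : realType) (f : PLo R) (p : unit_itv R) :
  PLact f p = p -> exists a b e : R, 0 < e /\ forall z,
    `|pos z - pos p| < e ->
    pos (PLact f z) - pos p = (if pos p <= pos z then a else b) * (pos z - pos p).
Proof.
move=> fp; have [_ _ [B finB fB0]] := PLoP f.
have fB x y : (forall z, pos x < pos z < pos y -> ~ B z) -> exists a b : R,
    forall z, pos x <= pos z <= pos y -> pos (PLact f z) = a * pos z + b.
  exact: fB0.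
(* [p] may itself be a breakpoint; it is removed so that a ball around [p] misses all the others. *)
pose C : set R := @pos R @` (B `\ p).
have clC : closed C.
  apply: (accessible_finite_set_closed.1 _) => //.
    exact/hausdorff_accessible/Rhausdorff.
  by apply: finite_image; exact: finite_setD.
have /nbhs_ballP[e /= e0 eC] : nbhs (pos p) (~` C).
  apply: open_nbhs_nbhs; split; first exact: closed_openC.
  by move=> [q [_ qp]] /pos_inj.
have {}eC z : `|pos z - pos p| < e -> B z -> z = p.
  move=> ze Bz; have := eC (pos z); rewrite -ball_normE /= distrC => /(_ ze) nC.
  by apply: contrapT => zp; apply: nC; exists z.
have /andP[p0 p1] := unit_itvP p.
(* Half the radius keeps [y] within the ball; the truncation covers [p] near or at an end of
   [[0, 1]]. *)
have [y yE] : exists y : unit_itv R, pos y = Num.min (pos p + e / 2) 1.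
  by apply: unit_itv_mk; rewrite minEle; case: ifP => ?; lra.
have [x xE] : exists x : unit_itv R, pos x = Num.max (pos p - e / 2) 0.
  by apply: unit_itv_mk; rewrite maxEle; case: ifP => ?; lra.
have [z /andP[pz zy] Bz|a [a' fa]] := fB p y.
  have zp : z = p.
    apply: eC Bz; rewrite ger0_norm; last by rewrite subr_ge0 ltW.
    by move: zy; rewrite yE lt_min => /andP[? _]; lra.
  by rewrite zp ltxx in pz.
have [z /andP[xz zp] Bz|b [b' fb]] := fB x p.
  have z_p : z = p.
    apply: eC Bz; rewrite ltr0_norm; last by rewrite subr_lt0.
    by move: xz; rewrite xE gt_max => /andP[? _]; lra.
  by rewrite z_p ltxx in zp.
have py : pos p <= pos y by rewrite yE le_min p1 andbT; lra.
have xp : pos x <= pos p by rewrite xE ge_max p0 andbT; lra.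
exists a, b, (e / 2); split; first by rewrite divr_gt0.
move=> z; rewrite ltr_norml => /andP[z1 z2]; have /andP[z0 z1'] := unit_itvP z.
have := fa p; rewrite lexx py fp => /(_ isT) pa.
have {pa} a'E : a' = pos p - a * pos p by rewrite {1}pa; ring.
have := fb p; rewrite lexx xp fp => /(_ isT) pb.
have {pb} b'E : b' = pos p - b * pos p by rewrite {1}pb; ring.
case: ifP => pz.
  rewrite fa; first by rewrite a'E; ring.
  by rewrite pz yE le_min z1' andbT; lra.
rewrite fb; first by rewrite b'E; ring.
have {}pz : pos z < pos p by rewrite ltNge pz.
by rewrite (ltW pz) xE ge_max z0 !andbT; lra.
Qed.

(** On each side of a common fixed point both maps are scalings centred there, and scalings
    commute. *)
Lemma germ_commute (R : realType) (u v : PLo R) (p : unit_itv R) :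
  PLact u p = p -> PLact v p = p -> exists e : R, 0 < e /\ forall z,
    `|pos z - pos p| < e -> PLact [~ u, v]%g z = z.
Proof.
move=> up vp; have [a [b [e [e0 ue]]]] := germ_affine up.
have [c [d [e' [e'0 ve]]]] := germ_affine vp.
(* [M] is at least 1 and bounds all four slopes, so within [min e e' / M] of [p] the images under
   [u] and [v] stay in range of the linear formulas. *)
pose M := 1 + `|a| + `|b| + `|c| + `|d|.
have M1 : 1 <= M by rewrite /M; have := normr_ge0 a; have := normr_ge0 b;
  have := normr_ge0 c; have := normr_ge0 d; lra.
have M0 : 0 < M by lra.
exists (Num.min e e' / M); split; first by rewrite divr_gt0 // lt_min e0.
move=> z; rewrite ltr_pdivlMr // lt_min => /andP[ze ze'].
have zM : `|pos z - pos p| <= `|pos z - pos p| * M by rewrite ler_peMr.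
have uz := ue z (le_lt_trans zM ze); have vz := ve z (le_lt_trans zM ze').
have uz' : `|pos (PLact u z) - pos p| < e'.
  apply: le_lt_trans ze'; rewrite uz normrM mulrC ler_wpM2l //.
  by have := normr_ge0 a; have := normr_ge0 b; have := normr_ge0 c;
    have := normr_ge0 d; rewrite /M; case: ifP => _; lra.
have vz' : `|pos (PLact v z) - pos p| < e.
  apply: le_lt_trans ze; rewrite vz normrM mulrC ler_wpM2l //.
  by have := normr_ge0 a; have := normr_ge0 b; have := normr_ge0 c;
    have := normr_ge0 d; rewrite /M; case: ifP => _; lra.
have uvE : PLact u (PLact v z) = PLact v (PLact u z).
  apply/pos_inj/(addIr (- pos p)); rewrite (ue _ vz') (ve _ uz') vz uz.
  (* Each side of [p] is preserved, so the same one-sided slopes apply at the images. *)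
  have -> : (pos p <= pos (PLact v z)) = (pos p <= pos z) by rewrite -{1}vp PLact_le.
  have -> : (pos p <= pos (PLact u z)) = (pos p <= pos z) by rewrite -{1}up PLact_le.
  by case: ifP => _; ring.
have -> : ([~ u, v] = u^-1 * v^-1 * (u * v))%g by rewrite commgEl conjgE !mulgA.
by rewrite !PLactM uvE !PLactK.
Qed.

(* The one-sided slopes at p are homomorphisms to an abelian group. *)
Lemma commutator_subgroup_germ (R : realType) (H : set (PLo R)) p f :
  fixed H p -> commutator_subgroup H f ->
  exists e : R, 0 < e /\ forall z, `|pos z - pos p| < e -> PLact f z = z.
Proof.
move=> Hp; pose K : set (PLo R) := [set f | exists e : R, 0 < e /\
  forall z, `|pos z - pos p| < e -> PLact f z = z].
apply: (@commutator_subgroup_min _ H K) => [|u v Hu Hv]; last first.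
  by apply: germ_commute; exact: Hp.
apply: subgroupP => [|g h [d [d0 gd]] [e [e0 he]]|g [e [e0 ge]]].
- by exists 1.
- exists (Num.min d e); split; first by rewrite lt_min d0.
  by move=> z; rewrite lt_min => /andP[zd ze]; rewrite PLactM he ?gd.
- by exists e; split=> // z ze; rewrite -{1}(ge z ze) PLactK.
Qed.

Lemma commutator_subgroup_germ_seq (R : realType) (H : set (PLo R)) p
    (l : seq (PLo R)) :
  fixed H p -> (forall f, f \in l -> commutator_subgroup H f) ->
  exists e : R, 0 < e /\
    forall f z, f \in l -> `|pos z - pos p| < e -> PLact f z = z.
Proof.
move=> Hp; elim: l => [|g l IHl] Hl; first by exists 1.
have [f fl|d [d0 ld]] := IHl; first by apply: Hl; rewrite in_cons fl orbT.
have [e [e0 ge]] := commutator_subgroup_germ Hp (Hl g (mem_head _ _)).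
exists (Num.min d e); split; first by rewrite lt_min d0.
move=> f z; rewrite in_cons lt_min => /orP[/eqP->|fl] /andP[zd ze]; first exact: ge.
exact: ld.
Qed.

(** * Displacement of intervals *)

Lemma stabilizer_subgroup (R : realType) (p : unit_itv R) :
  is_subgroup [set f : PLo R | PLact f p = p].
Proof.
apply: subgroupP => //= [g h gp hp|g gp]; first by rewrite PLactM hp.
by rewrite -[in LHS]gp PLactK.
Qed.

Lemma zpow_fixed (R : realType) (t : PLo R) p j :
  PLact t p = p -> PLact (zpow t j) p = p.
Proof. exact: (@subgroup_zpow _ _ t j (stabilizer_subgroup p)). Qed.

Lemma zpow_mono (R : realType) (t : PLo R) p i j :
  pos p <= pos (PLact t p) -> i <= j ->
  pos (PLact (zpow t i) p) <= pos (PLact (zpow t j) p).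
Proof.
move=> tp ij; have -> : j = i + `|j - i|%N by lia.
elim: `|j - i|%N => [|n IHn]; first by rewrite addr0.
apply: le_trans IHn _; rewrite -[n.+1]addn1 PoszD addrA [zpow t (_ + 1)]zpowD PLactM.
by rewrite PLact_le.
Qed.

(** As [t c > d], positive powers of [t] put [[c, d]] to the right of [d] and negative ones to the
    left of [c], always inside [[e, e']] because [t] fixes its ends; there [l] acts trivially. *)
Lemma wreath_pair_itv (R : realType) (t : PLo R) c d e e' (l : seq (PLo R)) :
  PLact t e = e -> PLact t e' = e' -> pos e <= pos c -> pos d <= pos e' ->
  pos c <= pos d -> pos d < pos (PLact t c) ->
  (forall f z, f \in l -> pos e <= pos z <= pos c \/ pos d <= pos z <= pos e' ->
    PLact f z = z) ->
  wreath_pair (@PLact R) t [set z | pos c <= pos z <= pos d] l.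
Proof.
move=> te te' ec de' cd dtc lE.
have far (j : int) z : j != 0 -> pos c <= pos z <= pos d ->
    (pos e <= pos (PLact (zpow t j) z) < pos c) \/
    (pos d < pos (PLact (zpow t j) z) <= pos e').
  move=> j0 /andP[cz zd]; have [j1|j1] := lerP 1 j; [right|left].
    apply/andP; split.
      apply: (lt_le_trans dtc).
      have ctc : pos c <= pos (PLact t c) := le_trans cd (ltW dtc).
      by apply: (le_trans (zpow_mono ctc j1)); rewrite PLact_le.
    by rewrite -(zpow_fixed j te') PLact_le (le_trans zd).
  apply/andP; split; first by rewrite -(zpow_fixed j te) PLact_le (le_trans ec).
  apply: (@le_lt_trans _ _ (pos (PLact (zpow t (-1)) d))).
    apply: (@le_trans _ _ (pos (PLact (zpow t j) d))); first by rewrite PLact_le.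
    apply: zpow_mono; last by lia.
    by rewrite (le_trans (ltW dtc)) // PLact_le.
  by rewrite zpowN -(PLact_lt t) PLactKV.
split=> [j z j0 /(far _ _ j0)|f fl] /=; first by case=> /andP[]; lra.
split=> [z /andP[cz zd]|j z j0 /(far _ _ j0) zj].
  (* Fixing [c] and [d], [f] and its inverse preserve [[c, d]]. *)
  have fc : PLact f c = c by apply: lE fl _; left; rewrite ec lexx.
  have fd : PLact f d = d by apply: lE fl _; right; rewrite de' lexx.
  split; apply/andP; split.
  - by rewrite -fc PLact_le.
  - by rewrite -fd PLact_le.
  - by rewrite -(PLact_le f) fc PLactKV.
  - by rewrite -(PLact_le f) fd PLactKV.
by apply: lE fl _; case: zj => /andP[? ?]; [left|right]; apply/andP; split; lra.
Qed.

(** * Construction of towers of piecewise linear maps *)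

Definition supported_in (R : realType) (K : set (PLo R)) (a b c d : unit_itv R) :
    set (PLo R) :=
  [set f | K f /\ forall z,
    pos a <= pos z <= pos c \/ pos d <= pos z <= pos b -> PLact f z = z].

Lemma supported_in_subgroup (R : realType) (K : set (PLo R)) a b c d :
  is_subgroup K -> is_subgroup (supported_in K a b c d).
Proof.
move=> KG; apply: subgroupP => [|g h [Kg gE] [Kh hE]|g [Kg gE]].
- by split=> //; exact: subgroup1.
- split=> [|z zE]; first exact: (subgroupM KG Kg Kh).
  by rewrite PLactM hE // gE.
- by split=> [|z zE]; [exact: (subgroupV KG Kg)|rewrite -[in LHS](gE z zE) PLactK].
Qed.

(* Each element of K is supported in a compact subinterval of (a, b), and any
   such interval is displaced by an element of K: nested intervals obtained in
   this way make towers of every height. *)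
Lemma wreath_tower_compact_support (R : realType) (K : set (PLo R)) a b x n :
  is_subgroup K -> pos a < pos x < pos b ->
  (forall p, pos a < pos p < pos b -> ~ fixed K p) ->
  (forall p f, (p = a \/ p = b) -> K f ->
    exists e : R, 0 < e /\ forall z, `|pos z - pos p| < e -> PLact f z = z) ->
  exists c d, [/\ pos a < pos c, pos c <= pos x <= pos d, pos d < pos b &
    wreath_tower (@PLact R) x n (supported_in K a b c d)].
Proof.
move=> KG axb Kmoves Kgerm; elim: n => [|n [c [d [ac /andP[cx xd] db Kt]]]].
  by exists x, x; case/andP: axb => ax xb; split=> //; rewrite lexx.
(* The supremum of the orbit of [c] is fixed by [K], so it is not below [b]; hence some [g] carries
   [c] past [d]. *)
have [s [Ks cs sc]] := @orbit_sup _ K c KG.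
have bs : pos b <= pos s.
  rewrite leNgt; apply/negP => sb; apply: (Kmoves s) => //.
  by rewrite (lt_le_trans ac cs).
have [g Kg dgc] := sc _ (lt_le_trans db bs).
have [e1 [e10 ge1]] := Kgerm a g (or_introl erefl) Kg.
have [e2 [e20 ge2]] := Kgerm b g (or_intror erefl) Kg.
have /andP[a0 a1] := unit_itvP a; have /andP[b0 b1] := unit_itvP b.
have /andP[c0 c1] := unit_itvP c; have /andP[d0 d1] := unit_itvP d.
(* The enlarged interval must also make [g] trivial on [[a, c']] and [[d', b]]; halving keeps these
   closed pieces inside the open neighbourhoods given by the germs. *)
have [c' c'E] := @unit_itv_mk R (Num.min (pos c) (pos a + e1 / 2))
  ltac:(rewrite minEle; case: ifP => ?; lra).
have [d' d'E] := @unit_itv_mk R (Num.max (pos d) (pos b - e2 / 2))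
  ltac:(rewrite maxEle; case: ifP => ?; lra).
rewrite -/(pos _) in c'E; rewrite -/(pos _) in d'E.
have c'c : pos c' <= pos c by rewrite c'E ge_min lexx.
have dd' : pos d <= pos d' by rewrite d'E le_max lexx.
have c'e : pos c' <= pos a + e1 / 2 by rewrite c'E ge_min lexx orbT.
have d'e : pos b - e2 / 2 <= pos d' by rewrite d'E le_max lexx orbT.
exists c', d'; split.
- by rewrite c'E lt_min ac /=; lra.
- by rewrite (le_trans c'c) // (le_trans xd).
- by rewrite d'E gt_max db /=; lra.
exists (supported_in K a b c d); split=> //.
- exact: supported_in_subgroup.
- move=> f [Kf fE]; split=> // z zE; apply: fE.
  by case: zE => /andP[? ?]; [left|right]; apply/andP; split; lra.
move=> l lK; exists g, [set z | pos c <= pos z <= pos d]; split.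
- split=> // z [] /andP[? ?]; [apply: ge1|apply: ge2].
    by rewrite ger0_norm; lra.
  by rewrite ler0_norm; lra.
- by rewrite /= cx.
apply: (@wreath_pair_itv _ _ _ _ a b) => //.
- by apply: ge1; rewrite subrr normr0.
- by apply: ge2; rewrite subrr normr0.
- exact: ltW.
- exact: ltW.
- exact: le_trans xd.
- by move=> f z /lK[_]; apply.
Qed.

(* The endpoints of the orbital of g around q are limits of fixed points of H',
   so H'' is trivial near them: its elements are supported, within this orbital,
   between two translates of q by powers of g. *)
Lemma wreath_tower_step (R : realType) (H : set (PLo R)) g q x n
  (H' := commutator_subgroup H) (H'' := commutator_subgroup H') :
  is_subgroup H -> H g -> fixed H' q -> pos q < pos (PLact g q) ->
  pos (PLact (g^-1)%g q) <= pos x <= pos (PLact g q) ->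
  wreath_tower (@PLact R) x n H'' -> wreath_tower (@PLact R) x n.+1 H.
Proof.
move=> HG Hg H'q qgq /andP[gx xg] tw.
have H'G : is_subgroup H' by exact: commutator_subgroup_closed.
have H''G : is_subgroup H'' by exact: commutator_subgroup_closed.
have H'H : H' `<=` H by exact: commutator_subgroup_sub.
have H''H' : H'' `<=` H' by exact: commutator_subgroup_sub.
exists H''; split=> //; first exact: subset_trans H''H' H'H.
(* The ends [e] and [e'] of the orbital of [g] are the extrema of the orbit of [q] under the powers
   of [g]. *)
pose C : set (PLo R) := range (zpow g).
have CG : is_subgroup C.
  apply: subgroupP => [|_ _ [i _ <-] [j _ <-]|_ [i _ <-]]; first by exists 0.
    by exists (i + j) => //; rewrite zpowD.
  by exists (- i) => //; rewrite zpowN.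
have Cg : C g by exists 1.
have [e' [Ce' qe' supe']] := @orbit_sup _ C q CG.
have [e [Ce eq infe]] := @orbit_inf _ C q CG.
have gqe' j : pos (PLact (zpow g j) q) <= pos e'.
  by rewrite -(zpow_fixed j (Ce' g Cg)) PLact_le.
have egq j : pos e <= pos (PLact (zpow g j) q).
  by rewrite -(zpow_fixed j (Ce g Cg)) PLact_le.
(* [H'] is normal in [H], so it fixes every translate of [q] by a power of [g]. *)
have H'gq j f : H' f -> PLact f (PLact (zpow g j) q) = PLact (zpow g j) q.
  move=> H'f; have fE : PLact (f ^ zpow g j)%g q = q.
    by apply: H'q; apply: commutator_subgroup_conj => //; exact: subgroup_zpow.
  by rewrite -{2}fE conjgE !PLactM PLactKV.
have H'e : fixed H' e.
  apply: fixed_mono => // f H'f; rewrite leNgt; apply/negP => /infe[_ [j _ <-]].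
  by rewrite -(H'gq j f H'f) PLact_lt ltNge egq.
have H'e' : fixed H' e'.
  apply: fixed_mono => // f H'f; rewrite -(PLact_le (f^-1)%g) PLactK leNgt.
  apply/negP => /supe'[_ [j _ <-]]; rewrite -(PLact_lt f) PLactKV H'gq //.
  by rewrite ltNge gqe'.
move=> l lH''.
have [e1 [e10 le1]] := commutator_subgroup_germ_seq H'e lH''.
have [e2 [e20 le2]] := commutator_subgroup_germ_seq H'e' lH''.
have [_ [i0 _ <-] i0e] := infe (pos e + e1) ltac:(lra).
have [_ [j0 _ <-] j0e] := supe' (pos e' - e2) ltac:(lra).
(* The bounds by [i0] and [j0] put [c] and [d] in the neighbourhoods where [l] is trivial; those by
   -1 and 1 give [c <= x <= d]. *)
have [i [ii i1]] : exists i : int, i <= i0 /\ i <= -1.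
  by exists (Num.min i0 (-1)); rewrite !ge_min !lexx orbT.
have [j [jj j1]] : exists j : int, j0 <= j /\ 1 <= j.
  by exists (Num.max j0 1); rewrite !le_max !lexx orbT.
pose c := PLact (zpow g i) q; pose d := PLact (zpow g j) q.
have cx : pos c <= pos x.
  apply: le_trans gx; apply: (le_trans (zpow_mono (ltW qgq) i1)).
  by rewrite zpowN.
have xd : pos x <= pos d by apply: (le_trans xg); exact: (zpow_mono (ltW qgq) j1).
(* This exponent sends [c = g^i q] to [g^(j + 1) q], just beyond [d = g^j q]. *)
exists (zpow g (j - i + 1)), [set z | pos c <= pos z <= pos d]; split.
- exact: subgroup_zpow.
- by rewrite /= cx.
have ce : pos c < pos e + e1 := le_lt_trans (zpow_mono (ltW qgq) ii) i0e.
have de : pos e' - e2 < pos d := lt_le_trans j0e (zpow_mono (ltW qgq) jj).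
apply: (@wreath_pair_itv _ _ _ _ e e') => //.
- by apply: zpow_fixed; exact: Ce.
- by apply: zpow_fixed; exact: Ce'.
- exact: egq.
- exact: gqe'.
- exact: le_trans xd.
- rewrite /c -PLactM -zpowD; rewrite addrAC subrK.
  by rewrite zpowD PLactM PLact_lt.
- move=> f z fl [] /andP[? ?]; [apply: le1|apply: le2] => //.
    by rewrite ger0_norm; lra.
  by rewrite ler0_norm; lra.
Qed.

(** * Descent along the derived series *)

Lemma derived_series_sub (gT : groupType) (H : set gT) n :
  is_subgroup H -> is_subgroup (derived_series n H) /\ derived_series n H `<=` H.
Proof.
move=> HG; elim: n => [|m [IH1 IH2]]; first by split.
split.
  exact: (@commutator_subgroup_closed _ (derived_series m H)).
by apply: (subset_trans _ IH2); exact: (commutator_subgroup_sub IH1).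
Qed.

(** Each storey costs two derived steps, because the induction passes from [H] to [H'']. *)
Lemma wreath_tower_derived (R : realType) (H : set (PLo R)) x n :
  is_subgroup H -> ~ fixed (derived_series n.*2 H) x ->
  wreath_tower (@PLact R) x n H.
Proof.
elim: n H => // n IHn H HG.
rewrite doubleS /derived_series !iterSr -/(derived_series _ _).
set H' := commutator_subgroup H; set H'' := commutator_subgroup H'.
have H'G : is_subgroup H' by exact: commutator_subgroup_closed.
have H''G : is_subgroup H'' by exact: commutator_subgroup_closed.
have H'H : H' `<=` H by exact: commutator_subgroup_sub.
have H''H' : H'' `<=` H' by exact: commutator_subgroup_sub.
move=> Hnx; have tw := IHn _ H''G Hnx.
have H'x : ~ fixed H' x.
  apply: contra_not Hnx => H'x f Hf; apply: H'x; apply: H''H'.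
  exact: (proj2 (derived_series_sub n.*2 H''G) _ Hf).
have Hx : ~ fixed H x := fun Hx => H'x (fun f H'f => Hx f (H'H f H'f)).
have [b [Hb xb supb]] := orbit_sup x HG; have [a [Ha ax infa]] := orbit_inf x HG.
have {}ax : pos a < pos x.
  by rewrite lt_neqAle ax andbT; apply/eqP => /pos_inj ax'; apply: Hx; rewrite -ax'.
have {}xb : pos x < pos b.
  by rewrite lt_neqAle xb andbT; apply/eqP => /pos_inj xb'; apply: Hx; rewrite xb'.
have [[q [/andP[aq qb] H'q]]|noq] := pselect (exists q, pos a < pos q < pos b /\ fixed H' q).
  have [qx|xq|/pos_inj qx] := ltgtP (pos q) (pos x).
  (* [g] takes [x] below [q], so [g^-1] takes [q] above [x] and plays the role of the element moving
     [q] to the right. *)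
  - have [g Hg gxq] := infa _ aq; have gq : pos x < pos (PLact (g^-1)%g q).
      by rewrite -(PLact_lt g) PLactKV.
    apply: (@wreath_tower_step _ H (g^-1)%g q) => //.
    + exact: (subgroupV HG Hg).
    + exact: lt_trans gq.
    + rewrite invgK (ltW gq) andbT; apply/ltW/(lt_trans _ qx)/(lt_trans _ gxq).
      by rewrite PLact_lt.
  - have [g Hg qgx] := supb _ qb; have gq : pos (PLact (g^-1)%g q) < pos x.
      by rewrite -(PLact_lt g) PLactKV.
    have qgq : pos q < pos (PLact g q) by rewrite (lt_trans qgx) // PLact_lt.
    apply: (@wreath_tower_step _ H g q) => //.
    by rewrite (ltW gq) ltW // (lt_trans xq).
  - by case: H'x; rewrite -qx.
(* [H'] has no fixed point between [a] and [b], and its germs at these points are trivial since [H]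
   fixes both; towers of any height follow without the induction. *)
have [| | |c [d [_ _ _]]] := @wreath_tower_compact_support _ H' a b x n.+1 H'G.
- by rewrite ax.
- by move=> p apb H'p; apply: noq; exists p.
- by move=> p f pab; apply: commutator_subgroup_germ; case: pab => ->.
by apply: wreath_tower_sub => f [/H'H].
Qed.

Theorem corollary1p3 (R : realType) (G : set (PLo R)) (hG : is_subgroup G)
  (law : satisfies_law G) : solvable_group G.
Proof.
have [k [_ [w [w0 wr Gw]]]] := law.
(* A tower of height [size w] is enough to violate [w], at two derived steps per storey. *)
exists (size w).*2; apply: contrapT => Gn1.
have [DG DsubG] := derived_series_sub (size w).*2 hG.
(* An element fixing every point is the identity, so a nontrivial derived term moves some point. *)
have [x Gx] : exists x, ~ fixed (derived_series (size w).*2 G) x.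
  apply: contrapT => Gfix; apply: Gn1; apply/seteqP.
    split=> [f Df|_ ->] /=; last exact: subgroup1.
  apply/val_inj/funext => x; apply: contrapT => fx; apply: Gfix; exists x => Dx.
  exact/fx/Dx.
have [h [Gh]] := wreath_tower_no_law (@PLact1 R) (@PLactM R) hG
  (wreath_tower_derived hG Gx) w0 wr (leqnn _).
by apply; have := Gw h Gh; rewrite /eval_word -/(word_val h w) => ->.
Qed.
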